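(* Let $\vec{k}=(k_1,\dots,k_\ell)$ be any vector of positive integers and let $\mathcal{K}$ be the set of all distinct rearrangements of $\vec k$. Then $$\widetilde{C}_{\mathcal{K}}(q,t)=\sum_{\pi\in\mathcal{D}_{\mathcal{K}}} q^{\mathrm{area}(\pi)}t^{\mathrm{depth}(\pi)}$$ is $q,t$-symmetric, i.e. $\widetilde{C}_{\mathcal{K}}(q,t)=\widetilde{C}_{\mathcal{K}}(t,q)$, where $\mathcal{D}_{\mathcal{K}}$ is the union of $\mathcal{D}_{\vec u}$ over $\vec u\in\mathcal{K}$.
   Context: For a vector $\vec{u}=(u_1,\dots,u_m)$ of positive integers put $|\vec u|=u_1+\cdots+u_m$ and $N=|\vec u|+m$. A $\vec u$-Dyck path is a word $\pi=\pi_1\cdots\pi_N$ containing the letters $S^{u_1},\dots,S^{u_m}$ exactly once each and in this order, together with $|\vec u|$ letters $W$, such that all starting ranks are nonnegative, where $r_1=0$, $r_{i+1}=r_i+u_j$ if $\pi_i=S^{u_j}$ and $r_{i+1}=r_i-1$ if $\pi_i=W$. $\mathcal{D}_{\vec u}$ is the set of such paths. The area sequence is $(a_1,\dots,a_m)$ with $a_j$ the starting rank of $S^{u_j}$, and $\mathrm{area}(\pi)=\sum a_j$. Filling algorithm $\eta_*$: in a tableau of $m$ top-justified columns, column $i$ having $u_i+1$ cells, place $1$ at the top of column 1; for $i=2,\dots,N$, call an entry active if it is currently the bottom entry of a column $i'$ not yet containing $u_{i'}+1$ entries; if $\pi_i=W$ place $i$ immediately below the largest active entry, otherwise place $i$ at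 the top of the first empty column. Ranking algorithm $\gamma_*$: column 1 gets ranks $0,1,\dots,u_1$ top to bottom; for $i\ge2$, if the top entry of column $i$ of $\eta_*(\pi)$ is $A+1$ and $A$ has rank $\alpha$, column $i$ gets ranks $\alpha,\dots,\alpha+u_i$ top to bottom. The depth labeling sequence $(d_1,\dots,d_m)$ is the first row of the ranking tableau and $\mathrm{depth}(\pi)=\sum d_j$. *)

(* Defs.v *)
From mathcomp Require Import all_boot all_order all_algebra.
Set Implicit Arguments. Unset Strict Implicit. Unset Printing Implicit Defensive.
Import GRing.Theory Num.Theory.

(* A word pi_1 ... pi_N over {S^{u_1},...,S^{u_m}, W} in which the S-letters
   occur exactly once each and in order is encoded by a bool word w:
   w_i = true  <-> pi_i is an S-letter (the j-th true letter is S^{u_j}),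
   w_i = false <-> pi_i = W. *)

Fixpoint ranks_from (u : seq nat) (r : int) (w : seq bool) : seq int :=
  match w with
  | [::] => [::]
  | b :: w' =>
      r :: (if b then ranks_from (behead u) (r + (head 0%N u)%:Z)%R w'
            else ranks_from u (r - 1)%R w')
  end.

Definition ranks (u : seq nat) (w : seq bool) : seq int := ranks_from u 0%R w.

Definition wlen (u : seq nat) : nat := (sumn u + size u)%N.

Definition is_dyck (u : seq nat) (w : seq bool) : bool :=
  [&& size w == wlen u, count id w == size u
    & all (fun r : int => (0 <= r)%R) (ranks u w)].

Definition area (u : seq nat) (w : seq bool) : nat :=
  \sum_(p <- zip w (ranks u w) | p.1) absz p.2.

(* a tableau is a list of m columns, each a list of entries, top to bottom *)

Definition bottom (cols : seq (seq nat)) (j : nat) : nat :=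
  last 0%N (nth [::] cols j).

Definition active_cols (u : seq nat) (cols : seq (seq nat)) : seq nat :=
  [seq j <- iota 0 (size cols) |
     (nth [::] cols j != [::]) && (size (nth [::] cols j) < (nth 0%N u j).+1)].

Definition fill_step (u : seq nat) (cols : seq (seq nat)) (ib : nat * bool)
  : seq (seq nat) :=
  let: (i, b) := ib in
  if b then
    let j := find (fun c : seq nat => c == [::]) cols in
    set_nth [::] cols j [:: i]
  else
    match active_cols u cols with
    | [::] => cols
    | j0 :: A =>
        let j := foldl (fun a j => if (bottom cols a < bottom cols j)%N then j else a)
                       j0 A in
        set_nth [::] cols j (rcons (nth [::] cols j) i)
    end.

Definition fill (u : seq nat) (w : seq bool) : seq (seq nat) :=
  foldl (fill_step u) (nseq (size u) [::]) (zip (iota 1 (size w)) w).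

(* rank of the cell in column j, row r (0-based) is toprank_j + r;
   topranks computes the first row (toprank of each column). *)
Definition next_toprank (cols : seq (seq nat)) (tr : seq nat) (i : nat) : nat :=
  if i == 0%N then 0%N
  else
    let A := (head 0%N (nth [::] cols i)).-1 in
    let j := find (fun c : seq nat => A \in c) cols in
    (nth 0%N tr j + index A (nth [::] cols j))%N.

Definition topranks (cols : seq (seq nat)) : seq nat :=
  foldl (fun tr i => rcons tr (next_toprank cols tr i)) [::] (iota 0 (size cols)).

Definition depth_seq (u : seq nat) (w : seq bool) : seq nat := topranks (fill u w).
Definition depth (u : seq nat) (w : seq bool) : nat := sumn (depth_seq u w).

Definition Ctilde (R : comPzRingType) (k : seq nat) (q t : R) : R :=
  (\sum_(u <- permutations k)
     \sum_(w : (wlen u).-tuple bool | is_dyck u w)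
        q ^+ area u w * t ^+ depth u w)%R.

(* Main.v *)
Require Import Defs.
From mathcomp Require Import all_boot all_order all_algebra zify.
Set Implicit Arguments. Unset Strict Implicit. Unset Printing Implicit Defensive.
Import GRing.Theory Num.Theory.

(** A nonempty Dyck path factors uniquely as [S^u D_0 W D_1 W ... W D_u] with
    Dyck paths [D_i], so paths are plane trees in which a node of type [u] has
    [u + 1] slots, each empty or holding one child; the nodes are the columns
    of the filling tableau and the slots are its cells.  A child in slot [i] of
    a node of type [u] has starting rank [a + (u - i)] and depth label [d + i],
    where [a] and [d] are those of its parent.  Reversing the slots of every
    node therefore exchanges area and depth, and it only permutes the types. *)

(* A column of cells, from top to bottom: [Cell c r] is a top cell carrying the
   child column [c] ([Nil] if there is none), above the rest [r]. *)
Inductive coltree := Nil | Cell of coltree & coltree.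

Fixpoint col_len (t : coltree) : nat :=
  if t is Cell _ r then (col_len r).+1 else 0.

Fixpoint ncells (t : coltree) : nat :=
  if t is Cell c r then (ncells c + ncells r).+1 else 0.

(* The flag [b] tells whether the tree is a whole column, starting with an
   S-letter, or the lower part of one, made of W-cells only. *)
Fixpoint word (b : bool) (t : coltree) : seq bool :=
  if t is Cell c r then b :: word true c ++ word false r else [::].

Fixpoint types (b : bool) (t : coltree) : seq nat :=
  if t is Cell c r then
    (if b then [:: col_len r] else [::]) ++ types true c ++ types false r
  else [::].

(* [e] is the rank at which the column starts, and hence also ends. *)
Fixpoint tree_area (b : bool) (e : nat) (t : coltree) : nat :=
  if t is Cell c r then
    (if b then e else 0) + tree_area true (e + col_len r) c + tree_area false e r
  else 0.

(** [d] is the rank of the top cell of [t] in the ranking tableau, and the child hanging from that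
    cell inherits it. *)
Fixpoint depth_labels (b : bool) (d : nat) (t : coltree) : seq nat :=
  if t is Cell c r then
    (if b then [:: d] else [::]) ++ depth_labels true d c
      ++ depth_labels false d.+1 r
  else [::].

Fixpoint col_cat (s t : coltree) : coltree :=
  if s is Cell c r then Cell c (col_cat r t) else t.

Fixpoint col_take (n : nat) (t : coltree) : coltree :=
  match n, t with
  | n'.+1, Cell c r => Cell c (col_take n' r)
  | _, _ => Nil
  end.

Fixpoint col_drop (n : nat) (t : coltree) : coltree :=
  match n, t with
  | n'.+1, Cell _ r => col_drop n' r
  | _, _ => t
  end.

(** Accumulator reversal as in [catrev], applied at every level of the tree. *)
Fixpoint mirror_onto (acc t : coltree) : coltree :=
  if t is Cell c r then mirror_onto (Cell (mirror_onto Nil c) acc) r else acc.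

Definition mirror := mirror_onto Nil.

(** * Joining and splitting columns *)

Lemma col_cats0 t : col_cat t Nil = t.
Proof. by elim: t => //= c _ r ->. Qed.

Lemma col_take_cat s t : col_take (col_len s) (col_cat s t) = s.
Proof. by elim: s => [|c _ r /= ->] //; case: t. Qed.

Lemma col_drop_cat s t : col_drop (col_len s) (col_cat s t) = t.
Proof. by elim: s => [|c _ r /= ->] //; case: t. Qed.

Lemma col_cat_take_drop n t : col_cat (col_take n t) (col_drop n t) = t.
Proof. by elim: n t => [|n IHn] [|c r] //=; rewrite IHn. Qed.

Lemma col_len_take n t : n <= col_len t -> col_len (col_take n t) = n.
Proof. by elim: n t => [|n IHn] [|c r] //= /IHn ->. Qed.

Lemma col_len_drop n t : col_len (col_drop n t) = col_len t - n.
Proof. by elim: n t => [|n IHn] [|c r] //=; rewrite IHn. Qed.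

Lemma word_cat s t : word false (col_cat s t) = word false s ++ word false t.
Proof. by elim: s => //= c _ r ->; rewrite catA. Qed.

Lemma types_cat s t : types false (col_cat s t) = types false s ++ types false t.
Proof. by elim: s => //= c _ r ->; rewrite catA. Qed.

Lemma size_word b t : size (word b t) = ncells t.
Proof. by elim: t b => //= c IHc r IHr b; rewrite size_cat IHc IHr. Qed.

(** * Mirroring *)

Lemma mirror_ontoK acc b t :
  mirror_onto acc (mirror_onto b t) = mirror_onto (col_cat t acc) b.
Proof.
elim: t acc b => //= c IHc r IHr acc b.
by rewrite IHr /= IHc col_cats0.
Qed.

Lemma mirrorK : involutive mirror.
Proof. by move=> t; rewrite /mirror mirror_ontoK col_cats0. Qed.

Lemma col_len_mirror_onto acc t :
  col_len (mirror_onto acc t) = col_len t + col_len acc.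
Proof. by elim: t acc => //= c _ r IHr acc; rewrite IHr /= addnS. Qed.

Lemma tree_area_true e t :
  tree_area true e t = (if col_len t == 0 then 0 else e) + tree_area false e t.
Proof. by case: t => //= c r; rewrite add0n addnA. Qed.

Lemma sumn_depth_labels_true d t :
  sumn (depth_labels true d t) =
    (if col_len t == 0 then 0 else d) + sumn (depth_labels false d t).
Proof. by case: t. Qed.

Lemma types_true t :
  types true t =
    (if col_len t == 0 then [::] else [:: (col_len t).-1]) ++ types false t.
Proof. by case: t. Qed.

(** The top cell of [t] comes to lie directly above [acc], so its child starts at rank
    [e + col_len acc], the very label it had. Moving the cell onto [acc] raises this value by one
    for the next cell, just as [depth_labels] does. *)
Lemma tree_area_mirror_onto e acc t :
  tree_area false e (mirror_onto acc t) =
    sumn (depth_labels false (e + col_len acc) t) + tree_area false e acc.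
Proof.
elim: t e acc => //= c IHc r IHr e acc.
rewrite IHr /= add0n sumn_cat tree_area_true col_len_mirror_onto IHc /=.
by rewrite !addn0 sumn_depth_labels_true addnS; lia.
Qed.

Lemma tree_area_mirror e t :
  tree_area true e (mirror t) = sumn (depth_labels true e t).
Proof.
rewrite tree_area_true sumn_depth_labels_true col_len_mirror_onto.
by rewrite tree_area_mirror_onto /= !addn0.
Qed.

Lemma types_mirror_onto acc t :
  perm_eq (types false (mirror_onto acc t)) (types false t ++ types false acc).
Proof.
elim: t acc => //= c IHc r IHr acc.
apply: perm_trans (IHr _) _.
rewrite /= perm_catCA catA perm_cat2r perm_cat2r.
rewrite !types_true col_len_mirror_onto /= addn0.
by rewrite perm_cat2l -[X in perm_eq _ X]cats0; exact: IHc.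
Qed.

Lemma types_mirror t : perm_eq (types true (mirror t)) (types true t).
Proof.
rewrite !types_true col_len_mirror_onto addn0 perm_cat2l.
by rewrite -[X in perm_eq _ X]cats0 types_mirror_onto.
Qed.

(** * Paths as trees *)

(** The result is built from the end of the word: a suffix starting at rank [h] is a path followed
    by [h] blocks, each a [W] followed by a path. The path goes into the top cell of the result and
    the blocks into the [h] cells below. An S-letter of value [x] takes the first [x] blocks to
    complete its column. *)
Fixpoint parse (u : seq nat) (w : seq bool) : coltree :=
  match w with
  | [::] => Cell Nil Nil
  | false :: w' => Cell Nil (parse u w')
  | true :: w' =>
      if parse (behead u) w' is Cell c r then
        Cell (Cell c (col_take (head 0 u) r)) (col_drop (head 0 u) r)
      else Nil
  end.

(** The hypothesis forces [w] to be empty or to start with [W], which always holds of what follows a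
    complete subtree. *)
Lemma parse_word t u w r : parse u w = Cell Nil r ->
  parse (types true t ++ u) (word true t ++ w) = Cell t r /\
  parse (types false t ++ u) (word false t ++ w) = Cell Nil (col_cat t r).
Proof.
elim: t u w r => //= c IHc s IHs u w r uw.
have [_ e] := IHs _ _ _ uw; have [{}e _] := IHc _ _ _ e.
by rewrite -!catA e col_take_cat col_drop_cat.
Qed.

Lemma wordK t : parse (types true t) (word true t) = Cell t Nil.
Proof.
by have [] := @parse_word t [::] [::] Nil erefl; rewrite !cats0.
Qed.

(** By the first two hypotheses [w] contains [h + sumn u] letters [W], so it descends from rank [h]
    to exactly 0. Hence each S-letter finds enough blocks to its right. *)
Lemma parse_suffix w u (h : nat) :
  size w = h + wlen u -> count id w = size u ->
  all (fun r : int => (0 <= r)%R) (ranks_from u h%:Z w) ->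
  exists c r, [/\ parse u w = Cell c r, col_len r = h,
    types true c ++ types false r = u & word true c ++ word false r = w].
Proof.
rewrite /wlen; elim: w u h => [|[] w IHw] u h /=.
- case: u h => [|x u] [|h] //= _ _ _.
  by exists Nil, Nil.
- case: u => [|x u] //= szw [cw] rkw.
  have szw' : size w = (h + x) + (sumn u + size u) by lia.
  have [c [r [-> lr <- <-]]] := IHw _ _ szw' cw rkw.
  exists (Cell c (col_take x r)), (col_drop x r); split=> //=.
  + by rewrite col_len_drop; lia.
  + by rewrite col_len_take ?lr ?leq_addl // -catA -types_cat col_cat_take_drop.
  + by rewrite -catA -word_cat col_cat_take_drop.
- rewrite add0n => szw cw rkw.
  (* A [W] cannot be read at rank 0: the next letter would start at a negative rank, and if the [W]
     is the last letter, the length forces [h = 1]. *)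
  have : 0 < h.
    case: w {IHw} szw cw rkw => [|b w]; first by case: u => //=; lia.
    by move=> _ _ /= /andP[]; lia.
  case: h szw rkw => // h szw rkw _.
  have rkw' : all (fun r : int => (0 <= r)%R) (ranks_from u h%:Z w).
    by move: rkw; rewrite (_ : (_ - 1)%R = Posz h) //; lia.
  have szw' : size w = h + (sumn u + size u) by lia.
  have [c [r [-> lr tu wu]]] := IHw _ _ szw' cw rkw'.
  by exists Nil, (Cell c r); rewrite /= tu wu lr.
Qed.

Definition tree_of (p : seq nat * seq bool) : coltree :=
  if parse p.1 p.2 is Cell c _ then c else Nil.

Definition path_of (t : coltree) : seq nat * seq bool :=
  (types true t, word true t).

Lemma path_ofK : cancel path_of tree_of.
Proof. by move=> t; rewrite /tree_of wordK. Qed.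

Lemma tree_ofK u w : is_dyck u w -> path_of (tree_of (u, w)) = (u, w).
Proof.
case/and3P=> /eqP szw /eqP cw rkw.
have [c [r [e lr tu wu]]] := @parse_suffix w u 0 szw cw rkw.
case: r lr => // _ in e tu wu *.
by rewrite /tree_of /path_of /= e -tu -wu /= !cats0.
Qed.

(** A whole column returns to its starting rank, while a lower part descends by one per cell; so [w]
    starts at rank [h] in both cases. *)
Lemma ranks_word t u w (h : nat) :
  all (fun r : int => (0 <= r)%R) (ranks_from u h%:Z w) ->
  all (fun r : int => (0 <= r)%R)
    (ranks_from (types true t ++ u) h%:Z (word true t ++ w)) /\
  all (fun r : int => (0 <= r)%R)
    (ranks_from (types false t ++ u) (h + col_len t)%:Z (word false t ++ w)).
Proof.
elim: t u w h => [|c IHc r IHr] u w h rkw /=; first by rewrite addn0.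
have [_ e] := IHr _ _ _ rkw; have [{}e _] := IHc _ _ _ e.
rewrite -!catA (_ : (_ - 1)%R = Posz (h + col_len r)); last by lia.
by rewrite -PoszD e.
Qed.

Lemma wlen_types t :
  wlen (types true t) = ncells t /\ wlen (types false t) + col_len t = ncells t.
Proof.
rewrite /wlen; elim: t => //= c [IHc _] r [_ IHr].
by rewrite !sumn_cat !size_cat; lia.
Qed.

Lemma count_word b t : count id (word b t) = size (types b t).
Proof. by elim: t b => //= c IHc r IHr [] /=; rewrite count_cat size_cat IHc IHr. Qed.

Lemma is_dyck_path_of t : is_dyck (path_of t).1 (path_of t).2.
Proof.
have [/= ok _] := @ranks_word t [::] [::] 0 isT.
rewrite /is_dyck /= size_word (wlen_types t).1 count_word !eqxx /=.
by rewrite !cats0 in ok.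
Qed.

Lemma area_word t u w (h : nat) :
  let area_from u (h : nat) w :=
    \sum_(p <- zip w (ranks_from u h%:Z w) | p.1) absz p.2 in
  area_from (types true t ++ u) h (word true t ++ w)
    = tree_area true h t + area_from u h w /\
  area_from (types false t ++ u) (h + col_len t) (word false t ++ w)
    = tree_area false h t + area_from u h w.
Proof.
move=> f; rewrite {}/f; elim: t u w h => [|c IHc r IHr] u w h /=.
  by rewrite addn0.
have [_ e] := IHr u w h.
rewrite !big_cons /= -!catA (_ : (_ - 1)%R = Posz (h + col_len r)); last by lia.
by rewrite -PoszD (IHc _ _ _).1 e; lia.
Qed.

Lemma area_path_of t : area (path_of t).1 (path_of t).2 = tree_area true 0 t.
Proof.
have [/=] := @area_word t [::] [::] 0.
by rewrite !cats0 big_nil addn0.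
Qed.

(** * The filling tableau *)

(** Each cell receives the position of its letter in the word; the word of its child comes in
    between, so the next cell of the column is [ncells c] further on. *)
Fixpoint col_entries (i : nat) (t : coltree) : seq nat :=
  if t is Cell c r then i :: col_entries (i.+1 + ncells c) r else [::].

Fixpoint tableau (b : bool) (i : nat) (t : coltree) : seq (seq nat) :=
  if t is Cell c r then
    (if b then [:: i :: col_entries (i.+1 + ncells c) r] else [::])
      ++ tableau true i.+1 c ++ tableau false (i.+1 + ncells c) r
  else [::].

Lemma size_col_entries i t : size (col_entries i t) = col_len t.
Proof. by elim: t i => //= c _ r IHr i; rewrite IHr. Qed.

Lemma map_size_tableau b i t :
  map size (tableau b i t) = map S (types b t).
Proof.
elim: t b i => //= c IHc r IHr b i.
by rewrite !map_cat IHc IHr; case: b => //=; rewrite size_col_entries.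
Qed.

Lemma size_tableau b i t : size (tableau b i t) = size (types b t).
Proof. by have /(congr1 size) := map_size_tableau b i t; rewrite !size_map. Qed.

Lemma flatten_tableau_true i t :
  flatten (tableau true i t) = col_entries i t ++ flatten (tableau false i t).
Proof. by case: t. Qed.

Lemma flatten_tableau i t :
  perm_eq (flatten (tableau true i t)) (iota i (ncells t)).
Proof.
elim: t i => // c IHc r IHr i.
rewrite flatten_tableau_true /= perm_cons flatten_cat iotaD.
rewrite perm_catCA perm_cat ?IHc //.
by rewrite -flatten_tableau_true IHr.
Qed.

Lemma nonnil_of_map_size (cols : seq (seq nat)) u :
  map size cols = map S u -> all (fun c : seq nat => c != [::]) cols.
Proof. by elim: cols u => [|c cols IH] [|x u] //= [sc /IH ->]; case: c sc. Qed.

Lemma tableau_nonnil b i t : all (fun c : seq nat => c != [::]) (tableau b i t).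
Proof. exact: nonnil_of_map_size (map_size_tableau b i t). Qed.

Lemma last_tableau i t :
  all (fun c => last 0 c < i + ncells t) (tableau true i t).
Proof.
apply/allP=> c ct.
have cN0 := allP (tableau_nonnil true i t) _ ct.
have : last 0 c \in iota i (ncells t).
  rewrite -(perm_mem (flatten_tableau i t)); apply/flattenP; exists c => //.
  by case: c cN0 {ct} => // x s _; exact: mem_last.
by rewrite mem_iota => /andP[].
Qed.

Lemma foldl_argmax (f : nat -> nat) (s : seq nat) a m :
  m \in a :: s -> {in a :: s, forall j, j != m -> f j < f m} ->
  foldl (fun a j => if f a < f j then j else a) a s = m.
Proof.
elim: s a => [|x s IHs] a /=; first by rewrite inE => /eqP.
move=> ms fs; apply: IHs => [|j].
- move: ms; rewrite !inE; case: (eqVneq m a) => [ma _|ma /=].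
    case: (eqVneq x m) => [xm|xm]; first by rewrite xm ma ltnn eqxx.
    have := fs x; rewrite !inE eqxx orbT ma => /(_ isT).
    by rewrite -ma => /(_ xm); case: ltngtP => //; rewrite eqxx.
  case: (eqVneq m x) => [mx _|_ /= ->]; last by rewrite orbT.
  have := fs a; rewrite !inE eqxx (eq_sym a m) ma => /(_ isT isT).
  by rewrite -mx => ->; rewrite eqxx.
- rewrite inE => /predU1P[->|js]; last by apply: fs; rewrite !inE js !orbT.
  by case: ifP => _; apply: fs; rewrite !inE eqxx ?orbT.
Qed.

Lemma set_nth_cat (T : Type) (x0 : T) s1 y s2 z :
  set_nth x0 (s1 ++ y :: s2) (size s1) z = s1 ++ z :: s2.
Proof. by elim: s1 => //= x s1 ->. Qed.

Lemma fill_step_S u (C E : seq (seq nat)) i :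
  all (fun c : seq nat => c != [::]) C ->
  fill_step u (C ++ [::] :: E) (i, true) = C ++ [:: i] :: E.
Proof.
move=> CN0; rewrite /fill_step find_cat ifN /= ?addn0 ?set_nth_cat //.
by rewrite -all_predC; exact: CN0.
Qed.

(** The columns of [D] are full and the last [e] are empty, so only [col] and columns of [A] can be
    active, and [col] has the largest bottom entry. *)
Lemma fill_step_W u1 x uD u2 (A : seq (seq nat)) (col : seq nat) D e i :
  size A = size u1 -> map size D = map S uD -> col != [::] -> size col <= x ->
  all (fun c => last 0 c < last 0 col) A ->
  fill_step (u1 ++ x :: uD ++ u2) (A ++ col :: D ++ nseq e [::]) (i, false)
    = A ++ rcons col i :: D ++ nseq e [::].
Proof.
move=> sA sD colN0 scol lA; rewrite /fill_step.
set u := u1 ++ _; set cols := A ++ _.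
have colA : nth [::] cols (size A) = col by rewrite nth_cat ltnn subnn.
have mA : size A \in active_cols u cols.
  rewrite mem_filter colA colN0 mem_iota size_cat /= sA.
  by rewrite nth_cat ltnn subnn /= ltnS scol addnS ltnS leq_addr.
have mx : {in active_cols u cols, forall j, j != size A ->
    bottom cols j < bottom cols (size A)}.
  move=> j; rewrite mem_filter => /andP[/andP[cjN0 cj] _] jA.
  rewrite /bottom colA.
  have [jlt|jge] := ltnP j (size A).
    by rewrite /cols nth_cat jlt; apply: (allP lA); rewrite mem_nth.
  case: (j - size A) (subnKC jge) => [|k] ej.
    by rewrite -ej addn0 eqxx in jA.
  move: cjN0 cj; rewrite -ej /cols /u !nth_cat -sA.
  rewrite ltnNge leq_addr addKn /= !nth_cat.
  have szD : size D = size uD by have /(congr1 size) := sD; rewrite !size_map.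
  rewrite -szD; case: ltnP => kD; last by rewrite nth_nseq if_same.
  have := congr1 (fun s => nth 0 s k) sD.
  by rewrite (nth_map [::]) // (nth_map 0) -?szD // => -> _; rewrite ltnn.
case: (active_cols u cols) mA mx => // j0 s mA mx.
by rewrite (foldl_argmax mA mx) colA set_nth_cat.
Qed.

Definition run u cols i w := foldl (fill_step u) cols (zip (iota i (size w)) w).

Lemma run_cat u cols i w1 w2 :
  run u cols i (w1 ++ w2) = run u (run u cols i w1) (i + size w1) w2.
Proof. by rewrite /run size_cat iotaD zip_cat ?size_iota // foldl_cat. Qed.

Lemma run_cons u cols i b w :
  run u cols i (b :: w) = run u (fill_step u cols (i, b)) i.+1 w.
Proof. by []. Qed.

(* The columns of a subtree stay on top of the stack of active columns until
   they are full, so that reading its word leaves all other columns alone. *)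
Lemma run_word t :
  (forall u1 u2 (C : seq (seq nat)) e i, size C = size u1 ->
     all (fun c : seq nat => c != [::]) C -> all (fun c => last 0 c < i) C ->
     run (u1 ++ types true t ++ u2)
       (C ++ nseq (size (types true t) + e) [::]) i (word true t)
     = C ++ tableau true i t ++ nseq e [::]) /\
  (forall u1 x uD u2 (A : seq (seq nat)) (col : seq nat) D e i, size A = size u1 ->
     map size D = map S uD -> all (fun c : seq nat => c != [::]) A -> col != [::] ->
     size col + col_len t = x.+1 ->
     all (fun c => last 0 c < last 0 col) A -> last 0 col < i ->
     all (fun c => last 0 c < i) D ->
     run (u1 ++ x :: uD ++ types false t ++ u2)
       (A ++ col :: D ++ nseq (size (types false t) + e) [::]) i (word false t)
     = A ++ (col ++ col_entries i t) :: D ++ tableau false i t ++ nseq e [::]).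
Proof.
elim: t => [|c [IHc _] r [_ IHr]]; first by split=> * //=; rewrite cats0.
split=> [u1 u2 C e i sC CN0 lC | u1 x uD u2 A col D e i sA sD AN0 colN0 scol lA li lD].
- rewrite /= size_cat addSn run_cons fill_step_S // run_cat.
  (* While the child is read, the new column counts among the earlier ones; afterwards the columns
     of the child, all full, take the place of [D]. *)
  have := IHc (rcons u1 (col_len r)) (types false r ++ u2)
    (rcons C [:: i]) (size (types false r) + e) i.+1.
  rewrite !size_rcons sC !all_rcons CN0 /= ltnSn.
  rewrite (sub_all _ lC) => [|s /ltnW //].
  move=> /(_ erefl isT isT).
  rewrite !cat_rcons -!catA -addnA => ->.
  have := IHr u1 (col_len r) (types true c) u2 C [:: i] (tableau true i.+1 c)
    e (i.+1 + ncells c) sC (map_size_tableau _ _ _) CN0 isT (add1n _) lC.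
  by rewrite size_word => -> //; [rewrite addSn ltnS leq_addr | exact: last_tableau].
- rewrite /= in scol *; rewrite run_cons size_cat fill_step_W //; last by lia.
  rewrite run_cat.
  have DN0 := nonnil_of_map_size sD.
  have szD : size D = size uD by have /(congr1 size) := sD; rewrite !size_map.
  (* Here [A], the open column and [D] together are the earlier columns, since all their bottom
     entries are below [i.+1]. *)
  have := IHc (u1 ++ x :: uD) (types false r ++ u2)
    (A ++ rcons col i :: D) (size (types false r) + e) i.+1.
  rewrite !size_cat /= sA szD !all_cat /= AN0 DN0 last_rcons ltnSn.
  rewrite -size_eq0 size_rcons /=.
  rewrite (sub_all _ lD) => [|s /ltnW //].
  rewrite (sub_all _ lA) => [|s sl]; last by rewrite ltnS ltnW // (ltn_trans sl).
  move=> /(_ erefl isT isT).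
  rewrite -!catA /= -?catA -addnA => ->.
  have := IHr u1 x (uD ++ types true c) u2 A (rcons col i)
    (D ++ tableau true i.+1 c) e (i.+1 + ncells c) sA.
  have lt_i : i < i.+1 + ncells c by rewrite addSn ltnS leq_addr.
  rewrite !map_cat sD map_size_tableau AN0 -size_eq0 size_rcons.
  rewrite last_rcons all_cat last_tableau lt_i.
  rewrite (sub_all _ lA) => [|s sl]; last by rewrite (ltn_trans sl).
  rewrite (sub_all _ lD) => [|s sl]; last by lia.
  rewrite addSnnS => /(_ erefl isT isT scol isT isT isT).
  by rewrite size_word -!catA cat_rcons => ->.
Qed.

Lemma fill_path_of t : fill (path_of t).1 (path_of t).2 = tableau true 1 t.
Proof.
have := (run_word t).1 [::] [::] [::] 0 1 erefl isT isT.
by rewrite /= !cats0 addn0.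
Qed.

(** * Depth labels *)

(* [attached s1 s2]: each labelled column [x] of [s2] hangs from a cell of an
   earlier column [y], whose rank in the ranking tableau is the label of [x]. *)
Fixpoint attached (s1 s2 : seq (seq nat * nat)) : Prop :=
  if s2 is x :: s then
    (exists y j, [/\ y \in s1, j < size y.1, (nth 0 y.1 j).+1 = head 0 x.1
                   & x.2 = y.2 + j])
    /\ attached (rcons s1 x) s
  else True.

Lemma attached_cat s1 a b :
  attached s1 a -> attached (s1 ++ a) b -> attached s1 (a ++ b).
Proof.
elim: a s1 => [|x a IHa] s1 /=; first by rewrite cats0.
by move=> [xs1 ax] ab; split=> //; apply: IHa; rewrite // cat_rcons.
Qed.

Lemma size_depth_labels b d t : size (depth_labels b d t) = size (types b t).
Proof.
by elim: t b d => //= c IHc r IHr [] d; rewrite /= !size_cat IHc IHr.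
Qed.

(** In the first claim [t] is the part of the column [y] below the entries [p], so its top cell has
    rank [y.2 + size p]. In the second [t] hangs from cell [j] of [y], whose letter immediately
    precedes its own. *)
Lemma attached_tableau t i d :
  (forall s y p, y \in s -> y.1 = p ++ col_entries i t -> d = y.2 + size p ->
     attached s (zip (tableau false i t) (depth_labels false d t))) /\
  (forall s y j, y \in s -> j < size y.1 -> (nth 0 y.1 j).+1 = i ->
     d = y.2 + j -> attached s (zip (tableau true i t) (depth_labels true d t))).
Proof.
elim: t i d => [|c IHc r IHr] i d //.
(* This also serves the second claim: the columns after a whole column hang from its own cells,
   which is the case of empty [p]. *)
have lower s y p : y \in s -> y.1 = p ++ col_entries i (Cell c r) ->
    d = y.2 + size p ->
    attached s (zip (tableau false i (Cell c r)) (depth_labels false d (Cell c r))).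
  move=> ys y1 dy; rewrite /= zip_cat ?size_tableau ?size_depth_labels //.
  apply: attached_cat.
    apply: (IHc i.+1 d).2 ys _ _ dy; rewrite y1.
      by rewrite size_cat /= addnS ltnS leq_addr.
    by rewrite nth_cat ltnn subnn.
  apply: (IHr (i.+1 + ncells c) d.+1).1 (y) (rcons p i) _ _ _.
  - by rewrite mem_cat ys.
  - by rewrite cat_rcons.
  - by rewrite size_rcons addnS dy.
split=> // s y j ys jy yj dy /=; split; first by exists y, j.
apply: (lower _ (col_entries i (Cell c r), d) [::]) => //.
  by rewrite mem_rcons inE eqxx.
by rewrite addn0.
Qed.

Lemma find_uniq_flatten (x : nat) ss j :
  uniq (flatten ss) -> x \in nth [::] ss j ->
  find (fun c : seq nat => x \in c) ss = j.
Proof.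
elim: ss j => [|s ss IHss] [|j] //=; rewrite ?nth_nil //.
  by move=> _ ->.
rewrite cat_uniq => /and3P[_ /hasPn ns us] xj.
rewrite ifN ?(IHss j) //; apply: ns; apply/flattenP.
exists (nth [::] ss j) => //; apply: mem_nth.
by rewrite ltnNge; apply: contraL xj => ?; rewrite nth_default.
Qed.

(** The parent of each new column is already labelled, and as entries are distinct, the two searches
    in [next_toprank] find exactly the cell it hangs from. A nonempty [s1] keeps the special rule
    for the first column out of the induction. *)
Lemma topranks_attached s1 s2 : s1 != [::] ->
  uniq (flatten (map fst (s1 ++ s2))) -> attached s1 s2 ->
  foldl (fun tr i => rcons tr (next_toprank (map fst (s1 ++ s2)) tr i))
    (map snd s1) (iota (size s1) (size s2)) = map snd (s1 ++ s2).
Proof.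
elim: s2 s1 => [|x s2 IHs] s1 s1N0; first by rewrite cats0.
move=> us /= [[y [j [ys jy yj xy]]] att].
set cols := map fst _ in us *.
have -> : next_toprank cols (map snd s1) (size s1) = x.2.
  rewrite /next_toprank size_eq0 (negbTE s1N0).
  have -> : nth [::] cols (size s1) = x.1.
    by rewrite /cols map_cat nth_cat size_map ltnn subnn.
  rewrite -yj /=; set k := index y s1.
  have k1 : k < size s1 by rewrite index_mem.
  have ck : nth [::] cols k = y.1.
    by rewrite /cols map_cat nth_cat size_map k1 (nth_map y) // nth_index.
  rewrite (find_uniq_flatten (j := k)) // ck ?mem_nth //.
  rewrite (nth_map y) // nth_index // xy index_uniq //.
  have ycols : y.1 \in cols by apply: map_f; rewrite mem_cat ys.
  by case/splitPr: ycols us => p q; rewrite flatten_cat /= !cat_uniq => /and5P[].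
have := IHs (rcons s1 x).
rewrite cat_rcons map_rcons size_rcons => -> //.
by rewrite -size_eq0 size_rcons.
Qed.

Lemma depth_seq_path_of t :
  depth_seq (path_of t).1 (path_of t).2 = depth_labels true 0 t.
Proof.
rewrite /depth_seq fill_path_of; case: t => // c r.
(* The root column, labelled 0, starts the ranking; all others are attached below it. *)
set t := Cell c r; set x := (col_entries 1 t, 0).
pose s := zip (tableau false 1 t) (depth_labels false 0 t).
have szs : size (tableau false 1 t) = size (depth_labels false 0 t).
  by rewrite size_tableau size_depth_labels.
have tabE : tableau true 1 t = map fst ([:: x] ++ s).
  by rewrite /= -/(unzip1 _) unzip1_zip ?szs.
have labE : depth_labels true 0 t = map snd ([:: x] ++ s).
  by rewrite /= -/(unzip2 _) unzip2_zip ?szs.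
rewrite labE -(@topranks_attached [:: x] s) //.
- by rewrite /topranks tabE size_map.
- by rewrite -tabE (perm_uniq (flatten_tableau 1 t)) iota_uniq.
- by apply: (attached_tableau t 1 0).1 (x) [::] _ _ _; rewrite ?inE.
Qed.

(** * The symmetry *)

(** Mirroring may change [u], so the double sum is flattened to a sum over pairs. *)
Definition dyck_paths (k : seq nat) : seq (seq nat * seq bool) :=
  [seq (u, w) | u <- permutations k,
     w <- [seq tval v | v : (wlen u).-tuple bool
                          <- enum {: (wlen u).-tuple bool} & is_dyck u v]].

Lemma mem_dyck_paths k u w :
  ((u, w) \in dyck_paths k) = perm_eq u k && is_dyck u w.
Proof.
apply/allpairsPdep/andP=> [[u' [w' [uk]]] | [uk uw]].
  case/mapP=> v; rewrite mem_filter => /andP[vu _] -> [-> ->].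
  by rewrite -mem_permutations.
have szw : size w == wlen u by case/and3P: uw.
exists u, w; rewrite mem_permutations; split=> //.
by apply/mapP; exists (Tuple szw) => //; rewrite mem_filter mem_enum uw.
Qed.

Lemma dyck_paths_uniq k : uniq (dyck_paths k).
Proof.
apply: allpairs_uniq_dep => [|u _|[u w] [u' w'] _ _ [-> ->] //].
  exact: permutations_uniq.
by rewrite (map_inj_uniq val_inj) filter_uniq ?enum_uniq.
Qed.

Lemma Ctilde_dyck_paths (R : comPzRingType) k (q t : R) :
  Ctilde k q t =
  (\sum_(p <- dyck_paths k) q ^+ area p.1 p.2 * t ^+ depth p.1 p.2)%R.
Proof.
rewrite /Ctilde big_allpairs_dep /=; apply: eq_bigr => u _.
by rewrite big_map big_filter big_enum_cond.
Qed.

Definition mirror_path (p : seq nat * seq bool) : seq nat * seq bool :=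
  path_of (mirror (tree_of p)).

Lemma mirror_path_dyck k :
  {in dyck_paths k, forall p, mirror_path p \in dyck_paths k}.
Proof.
move=> [u w]; rewrite !mem_dyck_paths => /andP[uk uw].
rewrite is_dyck_path_of andbT (perm_trans (types_mirror _)) //.
by have [-> _] := tree_ofK uw.
Qed.

Lemma mirror_pathK k : {in dyck_paths k, involutive mirror_path}.
Proof.
move=> [u w]; rewrite mem_dyck_paths => /andP[_ uw].
by rewrite /mirror_path path_ofK mirrorK tree_ofK.
Qed.

Lemma area_mirror_path k :
  {in dyck_paths k, forall p,
    area (mirror_path p).1 (mirror_path p).2 = depth p.1 p.2}.
Proof.
move=> [u w]; rewrite mem_dyck_paths => /andP[_ uw].
rewrite area_path_of tree_area_mirror -depth_seq_path_of.
by rewrite tree_ofK.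
Qed.

Theorem theorem1p2 (R : comPzRingType) (k : seq nat) :
  all (fun x => 0 < x)%N k ->
  forall q t : R, Ctilde k q t = Ctilde k t q.
Proof.
move=> _ q t; rewrite !Ctilde_dyck_paths.
have mirror_perm : perm_eq (map mirror_path (dyck_paths k)) (dyck_paths k).
  apply: uniq_perm => [||p]; rewrite ?dyck_paths_uniq //.
    rewrite map_inj_in_uniq ?dyck_paths_uniq // => p p' pk p'k e.
    by rewrite -(mirror_pathK pk) e (mirror_pathK p'k).
  apply/mapP/idP=> [[p' p'k ->] | pk]; first exact: mirror_path_dyck.
  by exists (mirror_path p); rewrite ?mirror_path_dyck ?(mirror_pathK pk).
rewrite -(perm_big _ mirror_perm) big_map /= !big_seq.
apply: eq_bigr => p pk.
(* Read backwards at the mirror image of [p], the lemma turns the depth of that image into the area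
   of [p]. *)
rewrite -(area_mirror_path (mirror_path_dyck pk)) (mirror_pathK pk).
by rewrite (area_mirror_path pk) mulrC.
Qed.
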